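(* Let $\Omega$ be a bounded domain in $\mathbb{R}^k$, $k\ge2$, and let $F\colon\Omega\to[0,\infty]$ be a nonnegative upper semicontinuous function. Let $\mathcal{C}_F$ be the class of all subharmonic functions $u$ on $\Omega$ such that $u\le F$, and set $M(x):=\sup\{u(x):u\in\mathcal{C}_F\}$. Fix a constant $a>1$ and let $F_\nu:=\{x\in\Omega:F(x)\ge a^\nu\}$ for each $\nu>0$. Choose some real $p_*\in(0,k)$ and put $q_*=k-p_*$. Set $$\mu_{q_*}(\nu):=\sup\frac{m(F_\nu\cap B_k(x,R))}{R^{p_*}},\qquad\nu>0,$$ where the supremum is taken over all balls $B_k(x,R)$ contained in $\Omega$. Suppose that $\mu_{q_*}(\nu)$ is finite for any $\nu>0$ and $$\int_0^1\mu_{q_*}^-(s)\,ds^{1/q_*}<\infty.$$ Let $D>0$ and a positive integer $\lambda$ be so large that $$\frac{a}{D^{q_*}S_1}+\frac1{a^\lambda}\le1,$$ and define $$\rho(t):=\int_0^{\mu_{q_*}(t-\lambda)}\big(\mu_{q_*}^-(s)-t+1+\lambda\big)\,ds^{1/q_*},\qquad t>\lambda.$$ Then for all $x\in\Omega$, $$M(x)\le a^{\rho^-(D^{-1}\operatorname{dist}(x,\partial\Omega))}.$$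
   Context: $m$ is Lebesgue measure in $\mathbb{R}^k$, $B_k(x,R)$ is the open ball in $\mathbb{R}^k$, and $S_1$ is the volume of the unit ball of $\mathbb{R}^k$. Subharmonic functions are allowed to take the value $-\infty$. The integrals with respect to $ds^{1/q_*}$ are Stieltjes integrals, i.e. $ds^{1/q_*}=\frac1{q_*}s^{\frac1{q_*}-1}ds$. For a decreasing function $\eta$ on an interval $(\alpha,\beta)$ (finite or infinite) put $\eta^-(s)=\inf\{t\in(\alpha,\beta):\eta(t)\le s\}$ for $s\in(\lim_{t\to\beta}\eta(t),\infty)$. This is applied to $\mu_{q_*}$ on $(0,\infty)$ and to $\rho$ on $(\lambda,\infty)$, both of which are decreasing. *)

(* Defs.v *)
From HB Require Import structures.
From mathcomp Require Import all_boot all_order all_algebra.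
From mathcomp Require Import all_classical all_reals all_analysis.

Set Implicit Arguments.
Unset Strict Implicit.
Unset Printing Implicit Defensive.

Import Order.TTheory GRing.Theory Num.Theory.
Import numFieldTopology.Exports numFieldNormedType.Exports.

Local Open Scope classical_set_scope.
Local Open Scope ring_scope.

(* R^k is 'rV[R]_k; its topology is the product topology of the library, which
   coincides with the Euclidean one.  The library's norm and [ball] on 'rV[R]_k
   are those of the sup norm, hence the Euclidean versions below. *)

Section euclidean.
Context {R : realType} {k : nat}.
Implicit Types (x y : 'rV[R]_k) (r : R) (A : set 'rV[R]_k).

Definition enorm x : R := Num.sqrt (\sum_(i < k) x ord0 i ^+ 2).

Definition eball x r : set 'rV[R]_k := [set y | enorm (y - x) < r].

Definition closed_eball x r : set 'rV[R]_k := [set y | enorm (y - x) <= r].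

Definition boundary A : set 'rV[R]_k := closure A `\` A°.

Definition edist_to x A : R := inf [set enorm (x - y) | y in A].

Definition bounded_domain A :=
  [/\ A !=set0, open A, connected A & bounded_set A].

End euclidean.

(* The sigma-algebra on 'rV[R]_k generated by the coordinates (= Borel sets). *)
Section measurable_rV.
Context {R : realType} {k : nat}.

Let coord (i : 'I_k) (x : 'rV[R]_k) : R := x ord0 i.

Let rV0 : g_sigma_preimage coord set0.
Proof. exact: sigma_algebra0. Qed.

Let rVC A : g_sigma_preimage coord A -> g_sigma_preimage coord (~` A).
Proof. exact: sigma_algebraC. Qed.

Let rV_bigcup (F : (set 'rV[R]_k)^nat) :
  (forall i, g_sigma_preimage coord (F i)) ->
  g_sigma_preimage coord (\bigcup_i (F i)).
Proof. exact: sigma_algebra_bigcup. Qed.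

HB.instance Definition _ := @isMeasurable.Build default_measure_display
  'rV[R]_k (g_sigma_preimage coord) rV0 rVC rV_bigcup.

Lemma measurable_rV_coord (i : 'I_k) :
  measurable_fun [set: 'rV[R]_k] (fun x : 'rV[R]_k => x ord0 i).
Proof.
move=> _ Y mY; rewrite setTI; apply: sub_sigma_algebra => /=.
rewrite -bigcup_seq/=; exists i => /=; first by rewrite mem_index_enum.
by exists Y => //; rewrite setTI.
Qed.

Lemma measurable_fun_rVP d (T : measurableType d) (f : T -> 'rV[R]_k) :
  (forall i, measurable_fun [set: T] (fun t => f t ord0 i)) ->
  measurable_fun [set: T] f.
Proof.
move=> mf _ A mA.
have : preimage_set_system [set: T] f (g_sigma_preimage coord)
    ([set: T] `&` f @^-1` A).
  by exists A.
rewrite -g_sigma_preimage_comp; move: ([set: T] `&` _); apply: smallest_sub.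
  exact: sigma_algebra_measurable.
rewrite -bigcup_seq/=; apply: bigcup_sub => i _ B [C mC <-].
exact: (mf i).
Qed.

End measurable_rV.

Definition rV_cons {R : realType} {n : nat} (z : R * 'rV[R]_n) : 'rV[R]_n.+1 :=
  row_mx (z.1%:M : 'rV[R]_1) z.2.

Lemma measurable_rV_cons {R : realType} {n : nat} :
  measurable_fun [set: R * 'rV[R]_n] (@rV_cons R n).
Proof.
apply: measurable_fun_rVP => i.
case: (split_ordP (i : 'I_(1 + n))) => j ->.
- apply: (eq_measurable_fun fst) => [z _|]; last exact: measurable_fst.
  by rewrite /rV_cons (row_mxEl (z.1%:M : 'rV[R]_1)) mxE (ord1 j) eqxx mulr1n.
- apply: (eq_measurable_fun ((fun x : 'rV[R]_n => x ord0 j) \o snd)) => [z _|].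
    by rewrite /rV_cons (row_mxEr (z.1%:M : 'rV[R]_1)).
  by apply: measurableT_comp => //; exact: measurable_rV_coord.
Qed.

(* Iterated product of the one-dimensional Lebesgue measure; the long name is
   the library's measure structure on [pushforward]. *)
Fixpoint lebesgue_rV (R : realType) (n : nat) :
    {measure set 'rV[R]_n -> \bar R} :=
  match n with
  | 0 => dirac (0 : 'rV[R]_0)
  | n'.+1 => measure_function_pushforward__canonical__measure_function_Measure
      (@lebesgue_measure R \x^ lebesgue_rV R n')%E measurable_rV_cons
  end.

Lemma lebesgue_rVS (R : realType) (n : nat) (A : set 'rV[R]_n.+1) :
  lebesgue_rV R n.+1 A =
  pushforward (@lebesgue_measure R \x^ lebesgue_rV R n)%E (@rV_cons R n) A.
Proof. by []. Qed.

Section theory.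
Context {R : realType} {k : nat}.
Implicit Types (Omega : set 'rV[R]_k) (F u : 'rV[R]_k -> \bar R).
Local Open Scope ereal_scope.

Local Notation m := (lebesgue_rV R k).

Definition unit_ball_volume : R := fine (m (eball 0 1)).

(* Functions on [Omega] are total functions of which only the values on
   [Omega] matter. *)
Definition upper_semicontinuous_on Omega F :=
  forall x, Omega x -> forall c : R, F x < c%:E ->
    \forall y \near within Omega (nbhs x), F y < c%:E.

(* Sub-mean value property over balls; the function which is identically -oo
   is subharmonic. *)
Definition subharmonic_on Omega u :=
  [/\ forall x, Omega x -> u x < +oo,
      upper_semicontinuous_on Omega u &
      forall x r, (0 < r)%R -> closed_eball x r `<=` Omega ->
        u x <= ((fine (m (eball x r)))^-1)%:E * \int[m]_(y in eball x r) u y].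

Definition subharmonic_minorants Omega F : set ('rV[R]_k -> \bar R) :=
  [set u | subharmonic_on Omega u /\ forall x, Omega x -> u x <= F x].

Definition sup_minorant Omega F (x : 'rV[R]_k) : \bar R :=
  ereal_sup [set u x | u in subharmonic_minorants Omega F].

Definition superlevel (a : R) Omega F (nu : R) : set 'rV[R]_k :=
  [set x | Omega x /\ (a `^ nu)%:E <= F x].

Definition mu (a p : R) Omega F (nu : R) : \bar R :=
  ereal_sup [set m (superlevel a Omega F nu `&` eball xr.1 xr.2) *
                 ((xr.2 `^ p)^-1)%:E
            | xr in [set xr : 'rV[R]_k * R |
                     (0 < xr.2)%R /\ eball xr.1 xr.2 `<=` Omega]].

End theory.

Section inverse.
Context {R : realType}.
Implicit Types (I A : set R) (eta g : R -> \bar R).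
Local Open Scope ereal_scope.

(* eta^- for a decreasing [eta] on the interval [I]; it is +oo at the points
   [s] with no [t] in [I] such that eta t <= s. *)
Definition decr_inv I eta (s : R) : \bar R :=
  ereal_inf [set t%:E | t in [set t | I t /\ eta t <= s%:E]].

(* Stieltjes integral of [g] over [A] with respect to d(s^(1/q)). *)
Definition integral_dpow (q : R) A g : \bar R :=
  \int[lebesgue_measure]_(s in A) (g s * (q^-1 * s `^ (q^-1 - 1))%:E).

Definition mu_inv k (a p : R) (Omega : set 'rV[R]_k) (F : 'rV[R]_k -> \bar R) :
  R -> \bar R := decr_inv `]0%R, +oo[ (mu a p Omega F).

Definition rho k (a p : R) (lambda : nat) (Omega : set 'rV[R]_k)
    (F : 'rV[R]_k -> \bar R) (t : R) : \bar R :=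
  integral_dpow (k%:R - p)
    [set s | (0 < s)%R /\ s%:E < mu a p Omega F (t - lambda%:R)]
    (fun s => mu_inv a p Omega F s - t%:E + 1 + lambda%:R%:E).

Definition rho_inv k (a p : R) (lambda : nat) (Omega : set 'rV[R]_k)
    (F : 'rV[R]_k -> \bar R) : R -> \bar R :=
  decr_inv `]lambda%:R, +oo[ (rho a p lambda Omega F).

End inverse.

(* Main.v *)
(* Suppose that a subharmonic minorant u exceeds a^t at x, and put
   r_n = D mu(t - lambda + n)^(1/q).  If u <= a^(t+1) on B(x, r_0), then
   bounding u by a^(t+1) on F_(t-lambda) and by F < a^(t-lambda) off that set,
   the mean value inequality and the condition on D and lambda give
   u(x) <= a^t.  So u exceeds a^(t+1) somewhere in B(x, r_0), and iterating
   yields points y_n with u(y_n) > a^(t+n) and |y_n - x| < r_0 + ... + r_(n-1).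
   As s < mu(nu) forces nu <= mu^-(s), counting the n with s < mu(t - lambda + n)
   gives sum_n r_n <= D rho(t).  When D rho(t) <= dist(x, boundary), the y_n stay
   in a compact subset of Omega, on which u is bounded: a contradiction. *)
Require Import Defs.
From mathcomp Require Import all_boot all_order all_algebra.
From mathcomp Require Import all_classical all_reals all_analysis.
From mathcomp Require Import measurable_realfun ring lra.
Import Order.TTheory GRing.Theory Num.Theory.
Import numFieldTopology.Exports numFieldNormedType.Exports.
Local Open Scope classical_set_scope.
Local Open Scope ring_scope.

Set Implicit Arguments.
Unset Strict Implicit.
Unset Printing Implicit Defensive.

(** * Euclidean balls *)

Section euclidean.
Context {R : realType} {k : nat}.
Implicit Types (x y z : 'rV[R]_k) (r : R) (A : set 'rV[R]_k).

Lemma enorm_ge0 x : 0 <= enorm x.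
Proof. exact: sqrtr_ge0. Qed.

Lemma sqr_enorm x : enorm x ^+ 2 = \sum_(i < k) x ord0 i ^+ 2.
Proof. by rewrite sqr_sqrtr// sumr_ge0// => i _; exact: sqr_ge0. Qed.

Lemma enorm0 : enorm (0 : 'rV[R]_k) = 0.
Proof. by rewrite /enorm big1 ?sqrtr0// => i _; rewrite mxE expr0n. Qed.

Lemma enormZ (c : R) x : enorm (c *: x) = `|c| * enorm x.
Proof.
rewrite /enorm -sqrtr_sqr -sqrtrM ?sqr_ge0// mulr_sumr; congr Num.sqrt.
by apply: eq_bigr => i _; rewrite mxE exprMn.
Qed.

Lemma enormN x : enorm (- x) = enorm x.
Proof. by rewrite -scaleN1r enormZ normrN1 mul1r. Qed.

Lemma enorm_distC x y : enorm (x - y) = enorm (y - x).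
Proof. by rewrite -enormN opprB. Qed.

(** Cauchy-Schwarz: expanding the nonnegative sum of [(|y| x_i - |x| y_i)^2] gives
    [2 |x| |y| (|x| |y| - s) >= 0], with [s] the dot product. The zero vectors are treated first so
    that the factor can be cancelled. *)
Lemma dot_le_enorm x y :
  \sum_(i < k) x ord0 i * y ord0 i <= enorm x * enorm y.
Proof.
have [x0|x0] := eqVneq (enorm x) 0.
  rewrite x0 mul0r big1// => i _.
  have /eqP := sqr_enorm x; rewrite x0 expr0n/= eq_sym psumr_eq0; last first.
    by move=> j _; exact: sqr_ge0.
  by move=> /allP/(_ i); rewrite mem_index_enum sqrf_eq0 => /(_ isT)/eqP ->; rewrite mul0r.
have [y0|y0] := eqVneq (enorm y) 0.
  rewrite y0 mulr0 big1// => i _.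
  have /eqP := sqr_enorm y; rewrite y0 expr0n/= eq_sym psumr_eq0; last first.
    by move=> j _; exact: sqr_ge0.
  by move=> /allP/(_ i); rewrite mem_index_enum sqrf_eq0 => /(_ isT)/eqP ->; rewrite mulr0.
have X0 : 0 < enorm x by rewrite lt0r x0 enorm_ge0.
have Y0 : 0 < enorm y by rewrite lt0r y0 enorm_ge0.
have : 0 <= \sum_(i < k) (enorm y * x ord0 i - enorm x * y ord0 i) ^+ 2.
  by apply: sumr_ge0 => i _; exact: sqr_ge0.
rewrite (eq_bigr (fun i => enorm y ^+ 2 * x ord0 i ^+ 2 +
    (enorm x ^+ 2 * y ord0 i ^+ 2 -
     2 * enorm x * enorm y * (x ord0 i * y ord0 i)))); last by move=> i _; ring.
rewrite big_split/= sumrB -!mulr_sumr -!sqr_enorm.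
move: (\sum_(i < k) _) => s H.
have : 0 <= (2 * enorm x * enorm y) * (enorm x * enorm y - s) by lra.
by rewrite pmulr_rge0 ?subr_ge0// !mulr_gt0.
Qed.

Lemma ler_enormD x y : enorm (x + y) <= enorm x + enorm y.
Proof.
rewrite -(@ler_pXn2r _ 2)// ?nnegrE ?addr_ge0 ?enorm_ge0//.
rewrite sqr_enorm (eq_bigr (fun i => x ord0 i ^+ 2 +
    (y ord0 i ^+ 2 + 2 * (x ord0 i * y ord0 i)))); last first.
  by move=> i _; rewrite mxE; ring.
rewrite !big_split/= -mulr_sumr -!sqr_enorm.
by have := dot_le_enorm x y; lra.
Qed.

Lemma ler_enorm_dist x y z : enorm (x - z) <= enorm (x - y) + enorm (y - z).
Proof. by rewrite (le_trans _ (ler_enormD _ _))// addrA subrK. Qed.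

Lemma coord_le_enorm x i : `|x ord0 i| <= enorm x.
Proof.
rewrite -sqrtr_sqr ler_sqrt ?sumr_ge0//; last by move=> j _; exact: sqr_ge0.
by rewrite (bigD1 i)//= lerDl sumr_ge0// => j _; exact: sqr_ge0.
Qed.

Lemma enorm_le_coord x (c : R) :
  (forall i, `|x ord0 i| <= c) -> enorm x <= k%:R * c.
Proof.
move=> xc; have [k0|k0] := posnP k.
  by rewrite /enorm big1 ?sqrtr0 ?k0 ?mul0r// => i; have := ltn_ord i; rewrite {2}k0.
have c0 : 0 <= c by exact: le_trans (xc (Ordinal k0)).
rewrite -(@ler_pXn2r _ 2)// ?nnegrE ?enorm_ge0 ?mulr_ge0//.
rewrite sqr_enorm (@le_trans _ _ (\sum_(i < k) c ^+ 2))//.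
  by apply: ler_sum => i _; rewrite -real_normK ?num_real// lerXn2r ?nnegrE.
rewrite sumr_const card_ord -[leLHS]mulr_natl exprMn ler_wpM2r ?sqr_ge0//.
by rewrite expr2 -natrM ler_nat leq_pmulr.
Qed.

Lemma norm_le_enorm x : `|x| <= enorm x.
Proof.
rewrite [leLHS]/Num.norm/= mx_normrE; apply/bigmax_leP; split => /=.
  exact: enorm_ge0.
by move=> [i j] _; rewrite (ord1 i); exact: coord_le_enorm.
Qed.

Lemma enorm_le_norm x : enorm x <= k%:R * `|x|.
Proof.
apply: enorm_le_coord => i.
by rewrite [leRHS]/Num.norm/= mx_normrE; apply: (le_bigmax _ _ (ord0, i)).
Qed.

(** The sup norm and the Euclidean norm bound each other up to the factor [k], so Euclidean balls
    form a base of the library topology. *)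
Lemma nbhs_eballP x A : nbhs x A <-> exists2 r, 0 < r & eball x r `<=` A.
Proof.
split=> [/(nbhs_normP x A).1[r /= r0 rA]|[r r0 rA]].
  exists r => // y xy; apply: rA => /=; rewrite distrC.
  exact: le_lt_trans (norm_le_enorm _) xy.
(* Dividing by [k.+1] instead of [k] keeps the radius meaningful when [k = 0]. *)
apply: (nbhs_normP x A).2; exists (r / k.+1%:R) => /=; first by rewrite divr_gt0.
move=> y /= xy; apply: rA; rewrite /eball/= enorm_distC.
rewrite (le_lt_trans (enorm_le_norm _))//.
rewrite (@le_lt_trans _ _ (k.+1%:R * `|x - y|)) ?ler_wpM2r ?ler_nat//.
by rewrite mulrC -ltr_pdivlMr.
Qed.

Lemma closed_eball_compact x r : compact (closed_eball x r).
Proof.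
apply: bounded_closed_compact.
  exists (`|x| + r); split; first exact: num_real.
  move=> M xM y xy; apply: ltW; apply: le_lt_trans xM.
  rewrite -[y](subrK x) addrC (le_trans (ler_normD _ _))// lerD2l.
  exact: le_trans (norm_le_enorm _) xy.
rewrite -openC openE => y /negP; rewrite -ltNge => xy; apply/nbhs_eballP.
exists (enorm (y - x) - r); first by rewrite subr_gt0.
move=> z zy; rewrite /closed_eball/=; apply/negP; rewrite -ltNge.
move: zy; rewrite /eball/= (enorm_distC z y).
by have := ler_enorm_dist y z x; lra.
Qed.

Lemma closed_eball_sub x y r s :
  enorm (y - x) + s < r -> closed_eball y s `<=` eball x r.
Proof.
move=> yxr z; rewrite /closed_eball/eball/=.
by have := ler_enorm_dist z y x; lra.
Qed.

(** The trace of [A] on the segment is relatively open, and also relatively closed because it equals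
    the trace of [closure A]. It contains [x], so by connectedness it is the whole segment. *)
Lemma segment_avoids_boundary A x y : open A -> A x ->
  (forall s : R, 0 <= s <= 1 -> ~ boundary A (x + s *: (y - x))) -> A y.
Proof.
move=> oA Ax bA.
pose f (s : R) := x + s *: (y - x).
have cf : continuous f.
  by move=> s; apply: cvgD; [exact: cvg_cst|apply: cvgZr_tmp; exact: cvg_id].
have cnt : connected (f @` `[0, 1]).
  apply: connected_continuous_connected; first exact: segment_connected.
  exact: continuous_subspaceT.
have E : (f @` `[0, 1]) `&` A = f @` `[0, 1].
  apply: cnt.
  - exists x; split => //; exists 0; rewrite /f ?scale0r ?addr0//=.
    by rewrite in_itv/= lexx ler01.
  - by exists A.
  - exists (closure A); first exact: closed_closure.
    apply/seteqP; split => z [[s s01 <-] Az]; split; try by exists s.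
      exact: subset_closure.
    apply: contrapT => nA; apply: (bA s); first by move: s01; rewrite /= in_itv.
    by split => //; move/interior_id : oA => ->.
have : (f @` `[0, 1]) y.
  by exists 1; rewrite /= ?in_itv/= ?lexx ?ler01// /f scale1r addrC subrK.
by rewrite -E => -[].
Qed.

(** A boundary point met at parameter [s] of the segment from [x] to [y] would be at distance
    [s * |y - x| < r] from [x]. *)
Lemma eball_edist_sub A x r : open A -> A x ->
  r <= edist_to x (boundary A) -> eball x r `<=` A.
Proof.
move=> oA Ax rA y yr; apply: (segment_avoids_boundary oA Ax) => s /andP[s0 s1] bs.
suff : r <= enorm (y - x) by rewrite leNgt yr.
apply: (le_trans rA); apply: (@le_trans _ _ (enorm (x - (x + s *: (y - x))))).
  apply: ge_inf; last by exists (x + s *: (y - x)).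
  by exists 0 => _ [z _ <-]; exact: enorm_ge0.
rewrite opprD addrA subrr add0r enormN enormZ ger0_norm//.
by rewrite ler_piMl ?enorm_ge0.
Qed.

(** The boundary must first be shown nonempty, since the infimum of the empty set is 0 by
    convention. If it were empty, segments would join [x] to every point inside [A], and [A] would
    be unbounded. *)
Lemma edist_boundary_gt0 A x : (0 < k)%N -> open A -> bounded_set A -> A x ->
  0 < edist_to x (boundary A).
Proof.
move=> k0 oA bA Ax.
have [z bz] : boundary A !=set0.
  apply/set0P/negP => /eqP b0.
  have AT y : A y by apply: (segment_avoids_boundary oA Ax) => s _; rewrite b0.
  case: bA => M [Mr] /(_ (`|M| + 1)); rewrite (le_lt_trans (ler_norm M)) ?ltrDl//.
  move=> /(_ isT (const_mx (`|M| + 2)) (AT _)).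
  have h : `|M| + 2 <= `|const_mx (`|M| + 2) : 'rV[R]_k|.
    rewrite [leRHS]/Num.norm/= mx_normrE.
    apply: le_trans (le_bigmax _ _ (ord0, Ordinal k0)); rewrite /= mxE.
    exact: ler_norm.
  by move=> /(le_trans h); rewrite lerD2l; lra.
have /nbhs_eballP[r r0 rA] : nbhs x A by move: oA; rewrite openE; exact.
apply: (lt_le_trans r0); apply: lb_le_inf; first by exists (enorm (x - z)), z.
move=> _ [y [_ By] <-]; rewrite leNgt; apply/negP => xy; apply: By.
move/interior_id: (oA) => ->.
by apply: rA; rewrite /eball/= enorm_distC.
Qed.

End euclidean.

(** * Borel sets and Lebesgue measure *)

Section borel.
Context {R : realType} {k : nat}.
Implicit Types (x y : 'rV[R]_k) (r : R) (A : set 'rV[R]_k).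

Lemma measurable_eball x r : measurable (eball x r).
Proof.
have [r0|r0] := leP r 0.
  rewrite (_ : eball x r = set0) -?subset0//.
  by move=> y; rewrite /eball/= ltNge (le_trans r0) ?enorm_ge0.
pose f y := \sum_(i < k) (y ord0 i - x ord0 i) ^+ 2.
have mf : measurable_fun setT f.
  apply: measurable_sum => i; apply: measurable_funX.
  by apply: measurable_funB => //; exact: measurable_rV_coord.
rewrite (_ : eball x r = setT `&` f @^-1` `]-oo, r ^+ 2[); first exact: mf.
rewrite setTI; apply/funext => y; apply/propext; rewrite /eball/= in_itv/=.
rewrite -(@ltr_pXn2r _ 2 _ (enorm (y - x)))// ?nnegrE ?enorm_ge0 ?ltW//.
by rewrite sqr_enorm; under eq_bigr do rewrite !mxE.
Qed.

(** An open set is the countable union of the balls with rational centre and radius that it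
    contains. *)
Lemma open_measurable_rV A : open A -> measurable A.
Proof.
move=> oA.
pose B (q : 'rV[rat]_k * rat) := eball (map_mx ratr q.1 : 'rV[R]_k) (ratr q.2).
rewrite (_ : A = \bigcup_(q : 'rV[rat]_k * rat)
    (if `[< B q `<=` A >] then B q else set0)); last first.
  apply/seteqP; split => [x Ax|x [q _]]; last by case: ifPn => // /asboolP; exact.
  have /nbhs_eballP[e e0 eA] : nbhs x A by move: oA; rewrite openE; exact.
  (* A radius [r < e / 2] with a centre closer than [r] to [x] gives a ball that contains [x] and
     lies in [eball x e]. *)
  have [r /itvP r0] : exists r : rat, (ratr r : R) \in `]0, (e / 2)[.
    by apply: rat_in_itvoo; rewrite divr_gt0.
  have rp : 0 < ratr r / k.+1%:R :> R by rewrite divr_gt0 ?r0.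
  have /choice[q hq] (i : 'I_k) : exists s : rat,
      `|ratr s - x ord0 i| < ratr r / k.+1%:R.
    have lt_itv : x ord0 i - ratr r / k.+1%:R < x ord0 i + ratr r / k.+1%:R by rewrite ltrD2l gtrN.
    have [s sx] := rat_in_itvoo lt_itv.
    by exists s; rewrite ltr_distl; move: sx; rewrite in_itv.
  pose Q : 'rV[R]_k := map_mx ratr (\row_i q i).
  have Qx : enorm (Q - x) < ratr r.
    rewrite (@le_lt_trans _ _ (k%:R * (ratr r / k.+1%:R)))//.
      by apply: enorm_le_coord => i; rewrite !mxE ltW.
    by rewrite mulrCA -[ltRHS]mulr1 ltr_pM2l ?r0// ltr_pdivrMr// mul1r ltr_nat.
  exists (\row_i q i, r) => //=.
  case: asboolP => [_|[]]; first by rewrite /B/= /eball/= enorm_distC.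
  move=> y; rewrite /B/eball/= -/Q => yQ; apply: eA; rewrite /eball/=.
  have := ler_enorm_dist y Q x; have : ratr r < e / 2 by rewrite r0.
  lra.
apply: countable_bigcupT_measurable => // q.
by case: ifP => // _; exact: measurable_eball.
Qed.

Lemma measurable_affine_rV (c : R) x :
  measurable_fun setT (fun y : 'rV[R]_k => c *: y + x).
Proof.
apply: measurable_fun_rVP => i.
apply: (eq_measurable_fun (fun y : 'rV[R]_k => c * y ord0 i + x ord0 i)).
  by move=> y _; rewrite !mxE.
apply: measurable_funD => //; apply: measurable_funM => //.
exact: measurable_rV_coord.
Qed.

End borel.

(** * Scaling of Lebesgue measure and the volume of balls *)

Section volume.
Context {R : realType}.
Local Notation lambda := (@lebesgue_measure R).

(** The pushforward under the affine map, multiplied by [c], agrees with Lebesgue measure on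
    half-open intervals; uniqueness of the latter gives the rest. *)
Lemma lebesgue_measure_affine (c b : R) (A : set R) : 0 < c -> measurable A ->
  lambda ((fun x => c * x + b) @^-1` A) = ((c^-1)%:E * lambda A)%E.
Proof.
move=> c0 mA; pose f x : measurableTypeR R := c * x + b.
have mf : measurable_fun (setT : set (measurableTypeR R)) f.
  by apply: measurable_funD => //; apply: measurable_funM.
have cge0 : 0 <= c by exact: ltW.
have -> : lambda A = (c%:E * lambda (f @^-1` A))%E.
  suff -> : lambda A = measure_function_mscale__canonical__measure_function_Measure
      (NngNum cge0)
      (measure_function_pushforward__canonical__measure_function_Measure lambda mf)
      A by [].
  apply: lebesgue_measure_unique => // _ [[u v]] _ <-.
  rewrite /= /mscale/= /pushforward.
  have -> : f @^-1` `]u, v] = `](u - b) / c, (v - b) / c]%classic.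
    apply/funext => x; apply/propext; rewrite /f/= !in_itv/=.
    by rewrite ltr_pdivrMr// ler_pdivlMr// mulrC ltrBlDr lerBrDr.
  rewrite !lebesgue_measure_itv/= !lte_fin ltr_pM2r ?invr_gt0// ltrD2r.
  case: ifP => _; last by rewrite mule0.
  by rewrite -EFinB -EFinM; congr EFin; field; rewrite gt_eqF.
by rewrite muleA -EFinM mulVf ?gt_eqF// mul1e.
Qed.

Lemma rV_consEl n (z : R * 'rV[R]_n) (j : 'I_1) :
  rV_cons z ord0 (lshift n j) = z.1.
Proof. by rewrite /rV_cons (row_mxEl (z.1%:M : 'rV[R]_1)) mxE (ord1 j) eqxx mulr1n. Qed.

Lemma rV_consEr n (z : R * 'rV[R]_n) (j : 'I_n) :
  rV_cons z ord0 (rshift 1 j) = z.2 ord0 j.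
Proof. by rewrite /rV_cons (row_mxEr (z.1%:M : 'rV[R]_1)). Qed.

Lemma rV_cons_affine n (c : R) (v : 'rV[R]_n.+1) (z : R * 'rV[R]_n) :
  c *: rV_cons z + v = rV_cons (c * z.1 + v ord0 (lshift n (ord0 : 'I_1)),
                                c *: z.2 + \row_j v ord0 (rshift 1 j)).
Proof.
apply/rowP => i; rewrite [LHS]mxE [X in X + _]mxE.
case: (split_ordP (i : 'I_(1 + n))) => j ->.
  by rewrite !rV_consEl (ord1 j).
by rewrite !rV_consEr/= !mxE.
Qed.

(** Induction on the dimension: the first coordinate contributes one factor [c^-1], the remaining
    ones [c^-n]. *)
Lemma lebesgue_rV_affine n (c : R) (v : 'rV[R]_n) (A : set 'rV[R]_n) :
  0 < c -> measurable A ->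
  lebesgue_rV R n ((fun y => c *: y + v) @^-1` A) =
  (((c ^+ n)^-1)%:E * lebesgue_rV R n A)%E.
Proof.
move=> c0; elim: n v A => [v A mA|n IH v A mA].
  rewrite expr0 invr1 mul1e; congr (lebesgue_rV R 0 _).
  by apply/seteqP; split => y /=; rewrite (thinmx0 (c *: y + v)) (thinmx0 y).
rewrite !lebesgue_rVS /pushforward /product_measure2.
set B := rV_cons @^-1` A.
have mB : measurable B by rewrite -[B]setTI; exact: measurable_rV_cons.
pose g (y : 'rV[R]_n) := c *: y + \row_j v ord0 (rshift 1 j).
have mg : measurable_fun setT g by exact: measurable_affine_rV.
pose phi := @lebesgue_measure R \o ysection B.
have mphi : measurable_fun setT phi by exact: measurable_fun_ysection.
(* The section at [y] of the preimage is the affine preimage of the section of [B] at [g y]. *)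
transitivity (\int[lebesgue_rV R n]_y (((c^-1)%:E * (phi \o g) y)))%E.
  apply: eq_integral => y _ /=.
  rewrite -(@lebesgue_measure_affine _ (v ord0 (lshift n (ord0 : 'I_1))))//; last first.
    exact: measurable_ysection.
  congr lebesgue_measure; apply/seteqP; split => x /=;
    by rewrite /ysection/= !inE /B/= rV_cons_affine.
rewrite ge0_integralZl//; last 2 first.
- exact: (measurableT_comp mphi mg).
- by rewrite lee_fin invr_ge0 ltW.
have cn0 : 0 <= (c ^+ n)^-1 by rewrite invr_ge0 exprn_ge0// ltW.
have phi0 y : (0 <= phi y)%E by exact: measure_ge0.
(* Change of variables: by the induction hypothesis, the pushforward under [g] is a constant
   multiple of the measure itself. *)
have -> : (\int[lebesgue_rV R n]_y (phi \o g) y =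
    ((c ^+ n)^-1)%:E * \int[lebesgue_rV R n]_y phi y)%E.
  transitivity (\int[pushforward (lebesgue_rV R n) g]_y phi y)%E.
    by rewrite (ge0_integral_pushforward mg).
  rewrite -(ge0_integral_mscale _ _ (NngNum cn0))//.
  apply: eq_measure_integral => C mC _.
  exact: (IH (\row_j v ord0 (rshift 1 j))).
by rewrite muleA -EFinM -invfM -exprS.
Qed.

(** Sup-norm balls: their measure is an explicit product, and placing the unit ball between two of
    them shows that its volume is finite and positive. *)
Definition cube n (r : R) : set 'rV[R]_n := [set y | forall i, `|y ord0 i| < r].
Arguments cube : clear implicits.

Lemma measurable_cube n (r : R) : measurable (cube n r).
Proof.
rewrite (_ : cube n r = \bigcap_(i in [set: 'I_n])
    (setT `&` (fun y : 'rV[R]_n => `|y ord0 i|) @^-1` `]-oo, r[)).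
  apply: fin_bigcap_measurable => // i _.
  have mi : measurable_fun setT (fun y : 'rV[R]_n => `|y ord0 i|).
    by apply: measurableT_comp => //; exact: measurable_rV_coord.
  by apply: mi => //; exact: measurable_itv.
apply/seteqP; split => y /= h i; first by move=> _; split => //; rewrite /= in_itv/=.
by have [_] := h i I; rewrite /= in_itv/=.
Qed.

Lemma lebesgue_rV_cube n (r : R) : 0 < r ->
  lebesgue_rV R n (cube n r) = ((2 * r) ^+ n)%:E.
Proof.
move=> r0; elim: n => [|n IH].
  rewrite expr0 /= /dirac indicE mem_set// => i; by have := ltn_ord i.
rewrite lebesgue_rVS /pushforward.
have -> : rV_cons @^-1` cube n.+1 r = `]- r, r[%classic `*` cube n r.
  apply/seteqP; split => [z h|z [/= z1 z2] i].
    split => /=.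
      by have := h (lshift n (ord0 : 'I_1)); rewrite rV_consEl in_itv/= ltr_norml.
    by move=> i; have := h (rshift 1 i); rewrite rV_consEr.
  case: (split_ordP (i : 'I_(1 + n))) => j ->.
    by rewrite rV_consEl ltr_norml; move: z1; rewrite in_itv.
  by rewrite rV_consEr.
transitivity (lambda `](- r)%R, r[%classic * lebesgue_rV R n (cube n r))%E.
  by apply: product_measure2E => //; exact: measurable_cube.
rewrite [X in (_ * X)%E]IH lebesgue_measure_itv/= lte_fin gtrN// -EFinB -EFinM.
by rewrite exprS opprK -mulr2n mulr_natl.
Qed.

Lemma unit_ball_volumeE n :
  lebesgue_rV R n (eball 0 1) = (@unit_ball_volume R n)%:E.
Proof.
rewrite /unit_ball_volume fineK// ge0_fin_numE ?measure_ge0//.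
apply: (@le_lt_trans _ _ (lebesgue_rV R n (cube n 1))).
  apply: le_measure; rewrite ?inE; [exact: measurable_eball|exact: measurable_cube|].
  move=> y; rewrite /eball/= subr0 => y1 i.
  exact: le_lt_trans (coord_le_enorm _ _) y1.
by rewrite lebesgue_rV_cube// ltry.
Qed.

Lemma unit_ball_volume_gt0 n : 0 < @unit_ball_volume R n.
Proof.
rewrite -lte_fin -unit_ball_volumeE.
have n0 : 0 < n.+1%:R^-1 :> R by rewrite invr_gt0.
apply: (@lt_le_trans _ _ (lebesgue_rV R n (cube n n.+1%:R^-1))).
  by rewrite lebesgue_rV_cube// lte_fin exprn_gt0// mulr_gt0.
apply: le_measure; rewrite ?inE; [exact: measurable_cube|exact: measurable_eball|].
move=> y yn; rewrite /eball/= subr0.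
rewrite (le_lt_trans (@enorm_le_coord _ _ _ n.+1%:R^-1 _))//.
  by move=> i; exact: ltW.
by rewrite ltr_pdivrMr// mul1r ltr_nat.
Qed.

Lemma eball_volume n (x : 'rV[R]_n) (r : R) : 0 < r ->
  lebesgue_rV R n (eball x r) = (r ^+ n * @unit_ball_volume R n)%:E.
Proof.
move=> r0.
have -> : eball x r = (fun y => r^-1 *: y + - (r^-1 *: x)) @^-1` eball 0 1.
  apply/funext => y; apply/propext; rewrite /eball/= subr0 -scalerBr enormZ.
  by rewrite gtr0_norm ?invr_gt0// mulrC ltr_pdivrMr// mul1r.
rewrite lebesgue_rV_affine ?invr_gt0//; last exact: measurable_eball.
by rewrite exprVn invrK unit_ball_volumeE EFinM.
Qed.

End volume.

(** * Subharmonic minorants *)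

Section subharmonic.
Context {R : realType} {k : nat}.
Implicit Types (Omega : set 'rV[R]_k) (F u : 'rV[R]_k -> \bar R) (x : 'rV[R]_k).
Local Notation m := (lebesgue_rV R k).
Local Notation S1 := (@unit_ball_volume R k).

Lemma usc_sublevel_open Omega u (c : R) : open Omega ->
  upper_semicontinuous_on Omega u -> open (Omega `&` [set x | (u x < c%:E)%E]).
Proof.
rewrite !openE => oO uscu x [Ox uxc].
by apply: filterS2 (oO _ Ox) (uscu _ Ox _ uxc) => y Oy uy; split => //; exact: uy.
Qed.

Lemma usc_measurable Omega u : open Omega ->
  upper_semicontinuous_on Omega u -> measurable_fun Omega u.
Proof.
move=> oO uscu.
apply: (measurability _ (ErealGenCInfty.measurableE R)).
move=> /= _ [_ [r ->]] <-.
rewrite (_ : _ `&` _ = Omega `\` (Omega `&` [set x | (u x < r%:E)%E])).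
  apply: measurableD; first exact: open_measurable_rV.
  by apply: open_measurable_rV; exact: usc_sublevel_open.
apply/seteqP; split => x /=; rewrite in_itv/= andbT.
  by move=> [Ox rx]; split => // -[_]; rewrite ltNge rx.
by move=> [Ox h]; split => //; rewrite leNgt; apply/negP => ux; exact: h.
Qed.

Lemma measurable_superlevel (a nu : R) Omega F : open Omega ->
  upper_semicontinuous_on Omega F -> measurable (superlevel a Omega F nu).
Proof.
move=> oO uscF.
have := usc_measurable oO uscF (open_measurable_rV oO)
  (emeasurable_itv `[(a `^ nu)%:E, +oo[).
congr measurable; apply/seteqP; split => x /=; rewrite in_itv/= andbT//.
Qed.

(** On the ball, [u] is at most [b] on the superlevel set and at most [F < a^nu] off it. The
    majorant [b 1_G + a^nu] is integrated and divided by the volume [r^k S1]. *)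
Lemma subharmonic_le_mean Omega F u (a nu b C p r : R) x : open Omega ->
  upper_semicontinuous_on Omega F -> subharmonic_minorants Omega F u ->
  0 < r -> closed_eball x r `<=` Omega -> 0 <= b ->
  (m (superlevel a Omega F nu `&` eball x r) <= (C * r `^ p)%:E)%E ->
  (forall y, eball x r y -> (u y <= b%:E)%E) ->
  (u x <= (b * (C * r `^ p) / (r ^+ k * S1) + a `^ nu)%:E)%E.
Proof.
move=> oO uscF [[uoo uscu mvu] uF] r0 rO b0 GC ub.
set G := superlevel a Omega F nu in GC.
have mG : measurable G by exact: measurable_superlevel.
have mB := measurable_eball x r.
have BO : eball x r `<=` Omega.
  by apply: subset_trans rO => y; rewrite /eball/closed_eball/=; exact: ltW.
have mu_B : measurable_fun (eball x r) u.
  apply: (measurable_funS _ BO); first exact: open_measurable_rV.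
  exact: usc_measurable.
have V0 : 0 < r ^+ k * S1 by rewrite mulr_gt0 ?exprn_gt0// unit_ball_volume_gt0.
have mG1 : measurable_fun (eball x r) (fun y => (\1_G y)%:E : \bar R).
  by apply/measurable_EFinP; exact: measurable_indic.
have I1 : (\int[m]_(y in eball x r) u y <=
    \int[m]_(y in eball x r) (b%:E * (\1_G y)%:E + (a `^ nu)%:E))%E.
  (* No lower bound for [u] is available, so its integral is compared with that of the positive
     part, where monotonicity for nonnegative functions applies. *)
  apply: (@le_trans _ _ (\int[m]_(y in eball x r) u^\+ y)%E).
    rewrite integralE -[leRHS]adde0; apply: leeD => //.
    by rewrite oppe_le0 integral_ge0.
  apply: ge0_le_integral => //.
  - exact: measurable_funepos.
  - by apply: emeasurable_funD => //; exact: measurable_funeM.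
  - move=> y By; rewrite funeposE ge_max; apply/andP; split; last first.
      by rewrite adde_ge0// ?lee_fin ?powR_ge0// mulr_ge0.
    rewrite indicE; case: (boolP (y \in G)) => yG.
      by rewrite mule1 (le_trans (ub _ By))// -EFinD lee_fin lerDl powR_ge0.
    rewrite mule0 add0e (le_trans (uF _ (BO _ By)))// leNgt; apply/negP => h.
    by move/negP: yG; apply; rewrite inE; split; [exact: BO|exact: ltW].
have I2 : (\int[m]_(y in eball x r) (b%:E * (\1_G y)%:E + (a `^ nu)%:E) <=
    (b * (C * r `^ p) + a `^ nu * (r ^+ k * S1))%:E)%E.
  rewrite ge0_integralD//; last 3 first.
  - by move=> y _; rewrite lee_fin mulr_ge0.
  - exact: measurable_funeM.
  - by move=> y _; rewrite lee_fin powR_ge0.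
  rewrite ge0_integralZl_EFin// integral_indic// integral_cst//.
  rewrite EFinD (EFinM b) (EFinM (a `^ nu)) -(eball_volume x)//; apply: leeD => //.
  by apply: lee_wpmul2l => //; rewrite lee_fin.
apply: (le_trans (mvu _ _ r0 rO)); rewrite eball_volume//=.
have -> : b * (C * r `^ p) / (r ^+ k * S1) + a `^ nu =
  (r ^+ k * S1)^-1 * (b * (C * r `^ p) + a `^ nu * (r ^+ k * S1)).
  by rewrite [RHS]mulrC mulrDl mulfK// gt_eqF.
rewrite EFinM; apply: lee_wpmul2l; first by rewrite lee_fin invr_ge0 ltW.
exact: le_trans I1 I2.
Qed.

Lemma superlevel_le_mu (a p nu M r : R) Omega F x :
  (mu a p Omega F nu <= M%:E)%E -> 0 < r -> eball x r `<=` Omega ->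
  (m (superlevel a Omega F nu `&` eball x r) <= (M * r `^ p)%:E)%E.
Proof.
move=> muM r0 rO.
have rp0 : 0 < r `^ p by exact: powR_gt0.
have : (m (superlevel a Omega F nu `&` eball x r) * ((r `^ p)^-1)%:E <= M%:E)%E.
  by apply: le_trans muM; apply: ereal_sup_ubound; exists (x, r).
by rewrite lee_pdivrMr// EFinM.
Qed.

(** The degenerate case, in which the radius of the iteration would vanish. The superlevel set is
    then null in every ball inside [Omega], so the mean value inequality on any small ball where [u]
    is bounded leaves only [a^nu]. *)
Lemma minorant_le_of_mu0 (a p nu : R) Omega F u x : open Omega ->
  upper_semicontinuous_on Omega F -> subharmonic_minorants Omega F u ->
  (mu a p Omega F nu <= 0)%E -> Omega x -> (u x <= (a `^ nu)%:E)%E.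
Proof.
move=> oO uscF uM mu0 Ox; have [[uoo uscu _] _] := uM.
have [b b0 ub] : exists2 b : R, 0 <= b & (u x < b%:E)%E.
  have := uoo x Ox; case: (u x) => [s| |]// _; last by exists 0; rewrite ?ltNyr.
  exists (`|s| + 1); first by rewrite addr_ge0.
  by rewrite lte_fin (le_lt_trans (ler_norm s))// ltrDl.
have := usc_sublevel_open oO uscu (c := b).
rewrite openE => /(_ x (conj Ox ub)) /nbhs_eballP[e e0 eO].
have r0 : 0 < e / 2 by rewrite divr_gt0.
have sub : closed_eball x (e / 2) `<=` eball x e.
  by move=> y; rewrite /closed_eball/eball/=; lra.
have sub' : eball x (e / 2) `<=` eball x e.
  by move=> y; rewrite /eball/=; lra.
have := @subharmonic_le_mean Omega F u a nu b 0 p _ x oO uscF uM r0.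
rewrite !(mul0r, mulr0) add0r; apply => //.
- by move=> y /sub /eO[].
- rewrite -(mul0r ((e / 2) `^ p)); apply: superlevel_le_mu => //.
  by move=> y /sub' /eO[].
- by move=> y /sub' /eO[_ /ltW].
Qed.

(** The radius is such that [r^q = D^q M]. The mean value bound then becomes [a^nu] times the
    left-hand side of the condition on [D] and [l]. *)
Lemma minorant_le_step (a p q D nu M : R) (l : nat) Omega F u x : open Omega ->
  upper_semicontinuous_on Omega F -> subharmonic_minorants Omega F u ->
  1 < a -> q = k%:R - p -> 0 < q -> 0 < D ->
  a / (D `^ q * S1) + 1 / a ^+ l <= 1 ->
  (mu a p Omega F (nu - l%:R) <= M%:E)%E -> 0 < M ->
  closed_eball x (D * M `^ q^-1) `<=` Omega ->
  (forall y, eball x (D * M `^ q^-1) y -> (u y <= (a `^ (nu + 1))%:E)%E) ->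
  (u x <= (a `^ nu)%:E)%E.
Proof.
move=> oO uscF uM a1 qE q0 D0 hD muM M0 rO ub.
set r := D * M `^ q^-1 in rO ub.
have a0 : 0 < a by rewrite (lt_trans _ a1).
have r0 : 0 < r by rewrite mulr_gt0// powR_gt0.
have BO : eball x r `<=` Omega.
  by apply: subset_trans rO => y; rewrite /eball/closed_eball/=; exact: ltW.
have GC := superlevel_le_mu muM r0 BO.
apply: (le_trans (subharmonic_le_mean oO uscF uM r0 rO (powR_ge0 _ _) GC ub)).
(* From [k = p + q]; the factor [M r^p] cancels against this in the quotient. *)
have rk : r ^+ k = r `^ p * (D `^ q * M).
  rewrite -powR_mulrn ?ltW// (_ : k%:R = p + q); last by rewrite qE addrC subrK.
  rewrite powRD; last by rewrite (gt_eqF r0) implybT.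
  by rewrite {2}/r powRM ?powR_ge0 ?(ltW D0)// -powRrM mulVf ?gt_eqF// powRr1// ltW.
have S0 := @unit_ball_volume_gt0 R k.
have Dq0 : 0 < D `^ q by exact: powR_gt0.
have rp0 : 0 < r `^ p by exact: powR_gt0.
have -> : a `^ (nu + 1) = a `^ nu * a.
  by rewrite powRD ?(gt_eqF a0) ?implybT// powRr1// ltW.
have -> : a `^ (nu - l%:R) = a `^ nu * (1 / a ^+ l).
  rewrite powRB ?(gt_eqF a0) ?implybT// powR_mulrn ?ltW//.
  by rewrite div1r.
rewrite lee_fin rk.
have -> : a `^ nu * a * (M * r `^ p) / (r `^ p * (D `^ q * M) * S1) +
    a `^ nu * (1 / a ^+ l) =
  a `^ nu * (a / (D `^ q * S1) + 1 / a ^+ l).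
  by field; rewrite !gt_eqF// exprn_gt0.
by rewrite -[leRHS]mulr1 ler_wpM2l// powR_ge0.
Qed.

End subharmonic.

(** * The Stieltjes integral defining rho *)

Section power_weight.
Context {R : realType}.
Variable q : R.
Hypothesis q0 : 0 < q.

Let w (s : R) : R := q^-1 * s `^ (q^-1 - 1).

Lemma power_weight_ge0 (s : R) : 0 <= w s.
Proof. by rewrite mulr_ge0 ?invr_ge0 ?powR_ge0// ltW. Qed.

Lemma measurable_power_weight (A : set R) : measurable_fun A w.
Proof.
by apply: measurable_funTS; apply: measurable_funM => //; exact: measurable_powR.
Qed.

Lemma integral_power_weight (e c : R) : 0 < e -> e < c ->
  (\int[lebesgue_measure]_(s in `[e, c]) (w s)%:E =
   (c `^ q^-1)%:E - (e `^ q^-1)%:E)%E.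
Proof.
move=> e0 ec.
have cpow (b s : R) : 0 < s -> {for s, continuous (fun x : R => x `^ b)}.
  move=> s0; apply: differentiable_continuous; apply/derivable1_diffP.
  by have [] := is_derive1_powR b s0.
apply: (@continuous_FTC2 _ w (fun s => s `^ q^-1)) => //.
- apply: continuous_in_subspaceT => s /[!inE]/=; rewrite in_itv/= => /andP[es _].
  by apply: cvgMl_tmp; apply: cpow; exact: lt_le_trans es.
- split.
  + move=> s; rewrite in_itv/= => /andP[es _].
    by have [] := is_derive1_powR q^-1 (lt_trans e0 es).
  + by apply: cvg_at_right_filter; exact: cpow.
  + by apply: cvg_at_left_filter; apply: cpow; exact: lt_trans ec.
- move=> s; rewrite in_itv/= => /andP[es _].
  by rewrite powR_derive1// in_itv/= andbT (lt_trans e0).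
Qed.

(** The weight may be singular at 0, so the integral is taken from some [e > 0] with [e^(1/q)] below
    a given error [d], which is then arbitrary. *)
Lemma power_le_integral (c : R) : 0 <= c ->
  ((c `^ q^-1)%:E <= \int[lebesgue_measure]_(s in `]0%R, c[) (w s)%:E)%E.
Proof.
move=> c0; have I0 : (0 <= \int[lebesgue_measure]_(s in `]0%R, c[) (w s)%:E)%E.
  by apply: integral_ge0 => s _; rewrite lee_fin power_weight_ge0.
move: c0; rewrite le_eqVlt => /predU1P[<-|c0].
  rewrite powR0 ?invr_eq0 ?gt_eqF//.
  by apply: integral_ge0 => s _; rewrite lee_fin power_weight_ge0.
apply/lee_addgt0Pr => d d0.
have dq0 : 0 < d `^ q by exact: powR_gt0.
pose e := Num.min (c / 2) (d `^ q).
have e0 : 0 < e by rewrite lt_min dq0 divr_gt0.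
have ec : e < c by rewrite gt_min ltr_pdivrMr// ltr_pMr// ltr1n.
have ed : e `^ q^-1 <= d.
  rewrite (@le_trans _ _ ((d `^ q) `^ q^-1))//.
    by rewrite ge0_ler_powR ?nnegrE ?invr_ge0 ?(ltW q0) ?(ltW e0) ?(ltW dq0)// ge_min lexx orbT.
  by rewrite -powRrM mulfV ?gt_eqF// powRr1// ltW.
have mw (A : set R) : measurable_fun A (fun s => (w s)%:E : \bar R).
  by apply/measurable_EFinP; exact: measurable_power_weight.
apply: (@le_trans _ _ (\int[lebesgue_measure]_(s in `[e, c]) (w s)%:E + d%:E)%E).
  by rewrite integral_power_weight// -EFinB -EFinD lee_fin; lra.
rewrite leeD2r// -integral_itv_bndo_bndc; last exact: mw.
apply: ge0_subset_integral => //.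
- exact: mw.
- by move=> s _; rewrite lee_fin power_weight_ge0.
- move=> s; rewrite /= !in_itv/= => /andP[es ->]; rewrite andbT.
  exact: lt_le_trans es.
Qed.

End power_weight.

(** * The generalized inverse of a decreasing function *)

Section decr_inv.
Context {R : realType}.
Variable eta : R -> \bar R.
Local Notation inv := (decr_inv `]0%R, +oo[ eta).

Lemma decr_inv_ge0 (s : R) : (0 <= inv s)%E.
Proof.
apply: le_ereal_inf_tmp => _ [t [t0 _] <-]; move: t0.
by rewrite /= in_itv/= andbT lee_fin => /ltW.
Qed.

Lemma decr_inv_anti (s s' : R) : s <= s' -> (inv s' <= inv s)%E.
Proof.
move=> ss'; apply: ereal_inf_le_tmp => _ [t [t0 ts] <-].
by exists t => //; split => //; exact: le_trans ts _.
Qed.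

Lemma measurable_decr_inv (A : set R) : measurable_fun A inv.
Proof.
apply: measurable_funTS.
apply: (measurability _ (ErealGenCInfty.measurableE R)).
move=> /= _ [_ [r ->]] <-; rewrite setTI; apply: is_interval_measurable.
move=> s t /=; rewrite !in_itv/= !andbT => _ rt u /andP[_ ut].
by rewrite in_itv/= andbT (le_trans rt)// decr_inv_anti.
Qed.

Lemma decr_inv_lty (s : R) : (inv s < +oo)%E ->
  exists2 t, 0 < t & (eta t <= s%:E)%E.
Proof.
move=> /ereal_inf_lt[_ [t [t0 ts] <-] _]; exists t => //.
by move: t0; rewrite /= in_itv/= andbT.
Qed.

Hypothesis eta_anti : forall s t : R, 0 < s -> s <= t -> (eta t <= eta s)%E.

Lemma lt_decr_inv (s tau : R) : (s%:E < eta tau)%E -> (tau%:E <= inv s)%E.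
Proof.
move=> st; apply: le_ereal_inf_tmp => _ [t [t0 ts] <-]; rewrite lee_fin leNgt.
apply/negP => ttau; move: st; rewrite ltNge => /negP; apply.
apply: le_trans ts; apply: eta_anti; last exact: ltW.
by move: t0; rewrite /= in_itv/= andbT.
Qed.

(** Every counted [n] has [tau + n <= inv s]; the final 1 accounts for [n = 0]. With
    [tau = t - lambda] the right-hand side is the integrand of [rho]. *)
Lemma count_le_decr_inv (s tau : R) (N : nat) : (s%:E < eta tau)%E ->
  ((\sum_(n < N) (s%:E < eta (tau + n%:R)%R)%E%:R)%:E <= inv s - tau%:E + 1)%E.
Proof.
move=> stau; elim: N => [|N IH].
  rewrite big_ord0; apply: adde_ge0 => //.
  by rewrite sube_ge0// lt_decr_inv.
(* If [N] is counted, the trivial bound [N + 1] on the count suffices; otherwise the count is the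
   previous one. *)
have [sN|] := boolP (s%:E < eta (tau + N%:R)%R)%E; last first.
  by rewrite big_ord_recr/= => /negbTE ->; rewrite addr0.
apply: (@le_trans _ _ (N.+1%:R)%:E).
  rewrite lee_fin (@le_trans _ _ (\sum_(n < N.+1) 1))//.
    by apply: ler_sum => n _; case: (_ < _)%E.
  by rewrite sumr_const card_ord.
apply: (@le_trans _ _ ((tau + N%:R)%:E - tau%:E + 1)%E).
  by rewrite -EFinB -EFinD lee_fin -natr1; lra.
by rewrite leeD2r// leeB// lt_decr_inv.
Qed.

End decr_inv.

(** * The sum of the radii and the smallness of rho *)

Section rho.
Context {R : realType}.
Variables (eta : R -> \bar R) (q : R).
Hypothesis q0 : 0 < q.
Hypothesis eta_anti : forall s t : R, 0 < s -> s <= t -> (eta t <= eta s)%E.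
Hypothesis eta_ge0 : forall t : R, 0 < t -> (0 <= eta t)%E.
Hypothesis eta_fin : forall t : R, 0 < t -> eta t \is a fin_num.
Local Notation inv := (decr_inv `]0%R, +oo[ eta).
Local Notation w := (fun s => q^-1 * s `^ (q^-1 - 1)).
Local Notation leb := (@lebesgue_measure R).

Lemma sub_eta_itv (tau : R) : 0 < tau ->
  [set s | 0 < s /\ (s%:E < eta tau)%E] = `]0, fine (eta tau)[%classic.
Proof.
move=> tau0; apply/seteqP; split => s /=; rewrite in_itv/=.
  by move=> [-> /=]; rewrite -lte_fin fineK ?eta_fin.
by move=> /andP[-> ]; rewrite -lte_fin fineK ?eta_fin.
Qed.

(** Each power is bounded by the integral of the weight over []0, eta (tau + n)[], a subinterval of
    []0, c[] because [eta] decreases. Exchanging sum and integral leaves the weight times the number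
    of [n] with [s < eta (tau + n)]. *)
Lemma sum_power_le_integral (tau : R) (N : nat) : 0 < tau ->
  ((\sum_(n < N) fine (eta (tau + n%:R)) `^ q^-1)%:E <=
   integral_dpow q [set s | (0 < s)%R /\ (s%:E < eta tau)%E]
     (fun s => inv s - tau%:E + 1))%E.
Proof.
move=> tau0; rewrite sub_eta_itv// /integral_dpow.
set c := fine (eta tau).
have taun0 n : 0 < tau + n%:R by rewrite ltr_wpDr.
pose f (n : 'I_N) (s : R) : \bar R :=
  ((s%:E < eta (tau + n%:R)%R)%E%:R * (q^-1 * s `^ (q^-1 - 1)))%:E.
have f0 n s : (0 <= f n s)%E.
  by rewrite lee_fin mulr_ge0// (power_weight_ge0 q0).
have mw (A : set R) : measurable_fun A w by exact: measurable_power_weight.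
have mf n (A : set R) : measurable_fun A (f n).
  apply/measurable_EFinP; apply: measurable_funM => //.
  apply: measurable_funTS.
  have -> : (fun s : R => (s%:E < eta (tau + n%:R)%R)%E%:R : R) =
      \1_(`]-oo, fine (eta (tau + n%:R)) [%classic).
    apply/funext => s; rewrite indicE mem_setE in_itv/= -lte_fin fineK//.
    exact: eta_fin.
  by apply: measurable_indic; exact: measurable_itv.
apply: (@le_trans _ _ (\sum_(n < N) \int[leb]_(s in `]0%R, c[) f n s)%E).
  rewrite -sumEFin; apply: lee_sum => n _.
  set cn := fine (eta (tau + n%:R)).
  have cn0 : 0 <= cn by rewrite fine_ge0// eta_ge0.
  have cnc : cn <= c.
    rewrite -lee_fin !fineK ?eta_fin//; apply: eta_anti => //.
    by rewrite lerDl.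
  apply: (le_trans (power_le_integral q0 cn0)).
  apply: (@le_trans _ _ (\int[leb]_(s in `]0%R, cn[) f n s)%E).
    rewrite le_eqVlt; apply/orP; left; apply/eqP; apply: eq_integral => s.
    rewrite inE/= in_itv/= => /andP[_ scn]; rewrite /f.
    by rewrite -(@fineK _ (eta (tau + n%:R))) ?eta_fin// lte_fin scn mul1r.
  apply: ge0_subset_integral => //; first exact: mf.
  move=> s /=; rewrite !in_itv/= => /andP[-> /=]; move/lt_le_trans; exact.
rewrite -ge0_integral_sum//; last by move=> n; exact: mf.
apply: ge0_le_integral => //.
- by move=> s _; apply: sume_ge0 => n _.
- by apply: emeasurable_sum => n; exact: mf.
- apply: emeasurable_funM; last by apply/measurable_EFinP; exact: mw.
  by apply: emeasurable_funD => //; apply: emeasurable_funB => //; exact: measurable_decr_inv.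
- move=> s; rewrite /= in_itv/= => /andP[s0 sc].
  have stau : (s%:E < eta tau)%E by rewrite -(fineK (eta_fin tau0)) lte_fin.
  rewrite /f sumEFin -mulr_suml EFinM.
  apply: lee_wpmul2r; first by rewrite lee_fin (power_weight_ge0 q0).
  exact: count_le_decr_inv.
Qed.

Hypothesis hint : (integral_dpow q `]0%R, 1%R[ inv < +oo)%E.

(** An infinite value at [s] would propagate to all smaller arguments by monotonicity, and the
    integral near 0 would diverge. *)
Lemma decr_inv_fin (s : R) : 0 < s -> (inv s < +oo)%E.
Proof.
move=> s0; rewrite ltey; apply/negP => /eqP invs.
pose e := Num.min s 1.
have e0 : 0 < e by rewrite lt_min s0 ltr01.
move: hint; rewrite ltNge => /negP; apply.
apply: (@le_trans _ _ (\int[leb]_(s in `]0%R, e[) (inv s * (w s)%:E))%E); last first.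
  apply: ge0_subset_integral => //.
  - apply: emeasurable_funM; first exact: measurable_decr_inv.
    by apply/measurable_EFinP; exact: measurable_power_weight.
  - by move=> t _; rewrite mule_ge0 ?decr_inv_ge0// lee_fin (power_weight_ge0 q0).
  - move=> t; rewrite /= !in_itv/= => /andP[-> /= te].
    by rewrite (lt_le_trans te)// ge_min lexx orbT.
rewrite (eq_integral (cst +oo%E)).
  have le : leb `]0, e[%classic = e%:E.
    by rewrite lebesgue_measure_itv/= lte_fin e0 oppr0 adde0.
  by rewrite integral_cst// [X in (_ * X)%E]le gt0_mulye.
move=> t; rewrite inE/= in_itv/= => /andP[t0 te].
have -> : inv t = +oo%E.
  apply/eqP; rewrite -leye_eq -invs; apply: decr_inv_anti.
  by rewrite ltW// (lt_le_trans te)// ge_min lexx.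
by rewrite gt0_mulye// lte_fin mulr_gt0 ?invr_gt0// powR_gt0.
Qed.

(** This makes the set defining [rho_inv] nonempty at positive arguments. For large [t] the range of
    integration is short, and absolute continuity of the convergent integral of [inv] makes the
    value small. *)
Lemma rho_small (lam : nat) (e : R) : 0 < e ->
  exists2 t : R, lam%:R < t &
   (integral_dpow q [set s | (0 < s)%R /\ (s%:E < eta (t - lam%:R)%R)%E]
     (fun s => inv s - t%:E + 1 + lam%:R%:E) <= e%:E)%E.
Proof.
move=> e0.
pose f (s : R) : \bar R := (inv s * (w s)%:E)%E.
have f0 s : (0 <= f s)%E.
  by rewrite mule_ge0 ?decr_inv_ge0// lee_fin (power_weight_ge0 q0).
have mw (A : set R) : measurable_fun A w by exact: measurable_power_weight.
have mf (A : set R) : measurable_fun A f.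
  apply: emeasurable_funM; first exact: measurable_decr_inv.
  by apply/measurable_EFinP; exact: mw.
(* A real-valued version of [f], cut off outside []0, 1[], to be integrable on the whole line. *)
pose g (s : R) : R := fine (f s) * \1_(`]0, 1[%classic) s.
have gf s : 0 < s -> s < 1 -> (g s)%:E = f s.
  move=> s0 s1; rewrite /g indicE mem_set/= ?in_itv/= ?s0 ?s1// mulr1 fineK//.
  rewrite fin_numM// ge0_fin_numE ?decr_inv_ge0//; exact: decr_inv_fin.
have g0 s : 0 <= g s by rewrite mulr_ge0// fine_ge0.
have mg (A : set R) : measurable_fun A g.
  apply: measurable_funM; first by apply: measurableT_comp.
  by apply: measurable_indic; exact: measurable_itv.
have intg : leb.-integrable setT (EFin \o g).
  apply/integrableP; split; first by apply/measurable_EFinP; exact: mg.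
  under eq_integral => s _ do rewrite /= ger0_norm//.
  rewrite (_ : (\int[leb]_x (g x)%:E)%E = (\int[leb]_(s in `]0%R, 1%R[) f s)%E)//.
  rewrite [RHS]integral_mkcond; apply: eq_integral => s _ /=.
  rewrite patchE; case: ifPn => [|sn].
    by rewrite inE/= in_itv/= => /andP[s0 s1]; exact: gf.
  by rewrite /g indicE (negbTE sn) mulr0.
have [d [d0 dg]] := integral_normr_continuous intg e0.
pose s0 : R := Num.min d 1 / 2.
have m0 : 0 < Num.min d 1 by rewrite lt_min d0 ltr01.
have s00 : 0 < s0 by rewrite divr_gt0.
(* Finiteness of [inv s0] provides a point where [eta] is at most [s0]. From there on the range of
   integration lies in []0, 1[] and is shorter than [d]. *)
have [t0 t00 ts0] := decr_inv_lty (decr_inv_fin s00).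
(* As [1 <= tau], the integrand is at most [inv s]. *)
pose tau := Num.max t0 1.
have tau0 : 0 < tau by rewrite lt_max t00.
have tau1 : 1 <= tau by rewrite le_max lexx orbT.
exists (tau + lam%:R); first by rewrite ltrDr.
rewrite addrK sub_eta_itv//; set c := fine (eta tau).
have cm : c < Num.min d 1.
  rewrite (@le_lt_trans _ _ s0)//; last by rewrite /s0; lra.
  rewrite -lee_fin fineK ?eta_fin//; apply: le_trans ts0; apply: eta_anti => //.
  by rewrite le_max lexx.
have c0 : 0 <= c by rewrite fine_ge0// eta_ge0.
move: cm; rewrite lt_min => /andP[cd c1].
have mc : (leb `]0%R, c[%classic < d%:E)%E.
  by rewrite lebesgue_measure_itv/= lte_fin; case: ifP => _; rewrite ?oppr0 ?adde0 lte_fin.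
have := dg _ (measurable_itv _) mc.
rewrite /Rintegral => dgc.
apply: (@le_trans _ _ (\int[leb]_(s in `]0%R, c[) f s)%E).
  apply: ge0_le_integral => //.
  - move=> s; rewrite /= in_itv/= => /andP[s0' sc].
    rewrite mule_ge0//; last by rewrite lee_fin (power_weight_ge0 q0).
    have : (tau%:E <= inv s)%E.
      by apply: lt_decr_inv => //; rewrite -(fineK (eta_fin tau0)) lte_fin.
    case: (inv s) => [r| |]//; first by rewrite -!EFinD !lee_fin; lra.
    by move=> _; exact: leey.
  - apply: emeasurable_funM; last by apply/measurable_EFinP; exact: mw.
    do 2 apply: emeasurable_funD => //.
    by apply: emeasurable_funB => //; exact: measurable_decr_inv.
  - exact: mf.
  - move=> s; rewrite /= in_itv/= => /andP[s0' sc].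
    apply: lee_wpmul2r; first by rewrite lee_fin (power_weight_ge0 q0).
    have := decr_inv_ge0 eta s; case: (inv s) => [r| |]// _.
    by rewrite -!EFinD lee_fin; lra.
have fg : (\int[leb]_(s in `]0%R, c[) f s = \int[leb]_(s in `]0%R, c[) (`|g s|)%:E)%E.
  apply: eq_integral => s; rewrite inE/= in_itv/= => /andP[s0' sc].
  by rewrite ger0_norm// gf// (lt_trans sc).
rewrite -fg in dgc.
rewrite -(@fineK _ (\int[leb]_(s in `]0%R, c[) f s)%E) ?lee_fin 1?ltW//.
rewrite ge0_fin_numE; last by apply: integral_ge0 => s _.
apply: le_lt_trans hint; apply: ge0_subset_integral => //; first exact: mf.
move=> s /=; rewrite !in_itv/= => /andP[-> /= sc]; exact: lt_trans c1.
Qed.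

End rho.

(** * The iteration *)

Section domar.
Context {R : realType} {k : nat}.
Implicit Types (Omega : set 'rV[R]_k) (F u : 'rV[R]_k -> \bar R) (x : 'rV[R]_k).

Lemma mu_anti (a p : R) Omega F (s t : R) : 1 < a -> open Omega ->
  upper_semicontinuous_on Omega F -> s <= t ->
  (mu a p Omega F t <= mu a p Omega F s)%E.
Proof.
move=> a1 oO uscF st; apply: ge_ereal_sup => _ [xr [r0 rO] <-].
apply: (@le_trans _ _ (lebesgue_rV R k (superlevel a Omega F s `&` eball xr.1 xr.2)
    * ((xr.2 `^ p)^-1)%:E)%E); last by apply: ereal_sup_ubound; exists xr.
apply: lee_wpmul2r; first by rewrite lee_fin invr_ge0 powR_ge0.
apply: le_measure; rewrite ?inE; try by apply: measurableI;
  [exact: measurable_superlevel|exact: measurable_eball].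
apply: setSI => y [Oy Fy]; split => //; apply: le_trans Fy.
by rewrite lee_fin ler_powR// ltW.
Qed.

Lemma mu_ge0 (a p : R) Omega F (t : R) : Omega !=set0 -> open Omega ->
  (0 <= mu a p Omega F t)%E.
Proof.
move=> [x Ox]; rewrite openE => /(_ _ Ox)/nbhs_eballP[r r0 rO].
apply: ereal_sup_ge; exists (lebesgue_rV R k (superlevel a Omega F t `&` eball x r)
    * ((r `^ p)^-1)%:E)%E; first by exists (x, r).
by apply: mule_ge0 => //; rewrite lee_fin invr_ge0 powR_ge0.
Qed.

(** Near each point [u] stays below some constant, hence below every large integer; compactness
    makes the integer uniform. *)
Lemma usc_bounded_compact Omega u (K : set 'rV[R]_k) : open Omega ->
  upper_semicontinuous_on Omega u -> (forall x, Omega x -> (u x < +oo)%E) ->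
  compact K -> K `<=` Omega ->
  exists n : nat, forall y, K y -> (u y < n%:R%:E)%E.
Proof.
move=> oO uscu uoo cK KO.
have /compact_near_coveringP ncK := cK.
have [|n _ Kn] := @ncK nat \oo (fun n y => (u y < n%:R%:E)%E) _; last first.
  by exists n => y Ky; apply: Kn => //=.
move=> x Kx; have Ox := KO _ Kx.
have [c uc] : exists c : R, (u x < c%:E)%E.
  have := uoo x Ox; case: (u x) => [s| |]// _; last by exists 0; rewrite ltNyr.
  by exists (s + 1); rewrite lte_fin ltrDl.
have := usc_sublevel_open oO uscu (c := c); rewrite openE => /(_ x (conj Ox uc)) nx.
exists (Omega `&` [set y | (u y < c%:E)%E], [set n | (Num.truncn c < n)%N]) => /=.
  by split => //; exact: nbhs_infty_gt.
move=> [y n] /= [[Oy uy] cn]; apply: (lt_le_trans uy); rewrite lee_fin ltW//.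
by rewrite (lt_le_trans (truncnS_gt c))// ler_nat.
Qed.

Lemma bernoulli_lower (a : R) (n : nat) : 1 <= a -> n%:R * (a - 1) <= a ^+ n.
Proof.
move=> a1; suff : 1 + n%:R * (a - 1) <= a ^+ n by lra.
elim: n => [|n IH]; first by rewrite expr0 mul0r addr0.
rewrite exprS -natr1; have : a * (1 + n%:R * (a - 1)) <= a * a ^+ n.
  by rewrite ler_pM2l// (lt_le_trans ltr01).
have : 0 <= n%:R * (a - 1) * (a - 1) by rewrite !mulr_ge0// subr_ge0.
by move: (n%:R) => m; lra.
Qed.

Lemma minorant_le_of_rho (a p D : R) (lam : nat) Omega F u x (t d : R) :
  1 < a -> p < k%:R -> open Omega -> upper_semicontinuous_on Omega F ->
  (forall nu : R, 0 < nu -> mu a p Omega F nu \is a fin_num) ->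
  0 < D -> (0 < lam)%N ->
  a / (D `^ (k%:R - p) * @unit_ball_volume R k) + 1 / a ^+ lam <= 1 ->
  subharmonic_minorants Omega F u ->
  eball x d `<=` Omega -> Omega x -> lam%:R < t ->
  (rho a p lam Omega F t <= (D^-1 * d)%:E)%E ->
  (u x <= (a `^ t)%:E)%E.
Proof.
move=> a1 pk oO uscF hmu D0 lam0 hD uM dO Ox lt rhot.
set q := k%:R - p in hD rhot.
have q0 : 0 < q by rewrite subr_gt0.
set tau := t - lam%:R.
have tau0 : 0 < tau by rewrite subr_gt0.
have taun0 (n : nat) : 0 < tau + n%:R by rewrite ltr_wpDr.
have Oex : Omega !=set0 by exists x.
have muA (s s' : R) : 0 < s -> s <= s' -> (mu a p Omega F s' <= mu a p Omega F s)%E.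
  by move=> _ ss'; exact: mu_anti.
pose M n := fine (mu a p Omega F (tau + n%:R)).
have muM n : mu a p Omega F (tau + n%:R) = (M n)%:E by rewrite fineK// hmu.
have M0 n : 0 <= M n by rewrite -lee_fin -muM mu_ge0.
have [r rE] : {r : nat -> R | forall n, r n = D * M n `^ q^-1} by eexists.
(* The integral bound at [tau = t - lam] gives [D * rho t], at most [d] by assumption; the
   integrands differ only in how the constants are grouped. *)
have sum_r N : \sum_(n < N) r n <= d.
  under eq_bigr do rewrite rE.
  rewrite -mulr_sumr mulrC -ler_pdivlMr// mulrC -lee_fin.
  apply: le_trans rhot.
  have := sum_power_le_integral q0 muA (fun t t0 => mu_ge0 a p F t Oex oO) hmu N tau0.
  move=> /le_trans; apply; rewrite /rho -/q le_eqVlt; apply/orP; left; apply/eqP.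
  apply: eq_integral => s _; congr (_ * _)%E.
  rewrite /mu_inv /tau; case: (decr_inv _ _ _) => [v| |]//.
  by rewrite -!EFinD; congr EFin; lra.
(* If [M j] vanished for some [j <= n + 1], the degenerate case would give
   [u y <= a^(t - lam + j) <= a^(t + n)], since [lam >= 1]. *)
have pos y n : Omega y -> ((a `^ (t + n%:R))%:E < u y)%E -> 0 < M n /\ 0 < M n.+1.
  move=> Oy uy.
  suff h j : (j <= n.+1)%N -> 0 < M j by split; apply: h.
  move=> jn; rewrite lt0r M0 andbT; apply/eqP => Mj0.
  have := @minorant_le_of_mu0 _ _ a p (tau + j%:R) _ _ _ y oO uscF uM.
  rewrite muM Mj0 lexx => /(_ isT Oy); rewrite leNgt => /negP; apply.
  apply: le_lt_trans uy; rewrite lee_fin ler_powR ?(ltW a1)// /tau.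
  have : (j%:R : R) <= n%:R + lam%:R by rewrite -natrD ler_nat (leq_trans jn)// -addn1 leq_add2l.
  lra.
have step y n : Omega y -> ((a `^ (t + n%:R))%:E < u y)%E ->
    closed_eball y (r n) `<=` Omega ->
    exists2 z, eball y (r n) z & ((a `^ (t + n.+1%:R))%:E < u z)%E.
  move=> Oy uy yO; apply: contrapT => h.
  have [Mn0 _] := pos _ _ Oy uy.
  move: uy; rewrite ltNge => /negP; apply.
  rewrite rE in yO h.
  apply: (minorant_le_step oO uscF uM a1 (erefl q) q0 D0 hD _ Mn0 yO) => [|z yz].
    by rewrite -muM /tau addrAC.
  rewrite leNgt; apply/negP => uz; apply: h; exists z => //.
  by rewrite -natr1 addrA.
rewrite leNgt; apply/negP => ux.
have ux0 : ((a `^ (t + 0%:R))%:E < u x)%E by rewrite addr0.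
have [_ M1] := pos _ _ Ox ux0.
(* Positivity of the second radius makes [r 0 < d] strict, so the first closed ball fits inside the
   open ball [eball x d]. *)
have r1 : 0 < r 1%N by rewrite rE mulr_gt0// powR_gt0.
have r0d : r 0%N < d.
  by have := sum_r 2%N; rewrite !big_ord_recr big_ord0 /= add0r; lra.
have [x1 xx1 ux1] : exists2 z, eball x (r 0%N) z & ((a `^ (t + 1%:R))%:E < u z)%E.
  apply: step => //; apply: subset_trans dO; apply: closed_eball_sub.
  by rewrite subrr enorm0 add0r.
(* The margin [del] keeps all further points in a closed ball inside [eball x d]. *)
pose del := r 0%N - enorm (x1 - x).
have del0 : 0 < del by rewrite subr_gt0.
have iter n : exists2 y, enorm (y - x) <= \sum_(i < n.+1) r i - del &
    ((a `^ (t + n.+1%:R))%:E < u y)%E.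
  elim: n => [|n [y yx uy]].
    by exists x1 => //; rewrite big_ord1 /del; lra.
  have Sn := sum_r n.+2; rewrite big_ord_recr/= in Sn.
  (* Strict because of [del], although the partial sums of radii may reach [d]. *)
  have yd : enorm (y - x) + r n.+1 < d by lra.
  have rn0 : 0 <= r n.+1 by rewrite rE mulr_ge0 ?powR_ge0// ltW.
  have Oy : Omega y by apply: dO; rewrite /eball/=; lra.
  have [|z yz uz] := step _ _ Oy uy.
    by apply: subset_trans dO; exact: closed_eball_sub.
  exists z => //; rewrite big_ord_recr/=.
  by move: yz; rewrite /eball/=; have := ler_enorm_dist z y x; lra.
have [[uoo uscu _] _] := uM.
have [N KN] : exists N : nat, forall y, closed_eball x (d - del) y -> (u y < N%:R%:E)%E.
  apply: (usc_bounded_compact oO uscu uoo (@closed_eball_compact _ _ _ _)).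
  by apply: subset_trans dO => y; rewrite /closed_eball/eball/=; lra.
(* Chosen so that [n (a - 1) > N]; Bernoulli's inequality then gives [a^n > N], and
   [t + n + 1 >= n]. *)
pose n := (Num.truncn (N%:R / (a - 1))).+1.
have nN : N%:R < a `^ (t + n.+1%:R).
  apply: (@lt_le_trans _ _ (n%:R * (a - 1))).
    by rewrite -ltr_pdivrMr ?subr_gt0// truncnS_gt.
  apply: (le_trans (bernoulli_lower _ (ltW a1))).
  rewrite -powR_mulrn; last by rewrite ltW// (lt_trans ltr01).
  rewrite ler_powR ?(ltW a1)// -natr1.
  have : 0 <= lam%:R :> R by [].
  lra.
have [y yx uy] := iter n.
have : (u y < N%:R%:E)%E by apply: KN; rewrite /closed_eball/=; have := sum_r n.+1; lra.
by move=> /(lt_trans uy); rewrite lte_fin ltNge ltW.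
Qed.

End domar.

(** * Passage from each admissible exponent to their infimum *)

Theorem theorem4p8 (R : realType) (k : nat) (hk : (2 <= k)%N)
  (Omega : set 'rV[R]_k) (hOmega : bounded_domain Omega)
  (F : 'rV[R]_k -> \bar R)
  (hF0 : forall x, Omega x -> (0 <= F x)%E)
  (hF : upper_semicontinuous_on Omega F)
  (a : R) (ha : 1 < a)
  (p q : R) (hp0 : 0 < p) (hpk : p < k%:R) (hq : q = k%:R - p)
  (hmu : forall nu : R, 0 < nu -> mu a p Omega F nu \is a fin_num)
  (hint : (integral_dpow q `]0%R, 1%R[ (mu_inv a p Omega F) < +oo)%E)
  (D : R) (hD : 0 < D) (lambda : nat) (hlambda : (0 < lambda)%N)
  (hDlambda :
     a / (D `^ q * @unit_ball_volume R k) + 1 / a ^+ lambda <= 1)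
  (x : 'rV[R]_k) (hx : Omega x) :
  let t := rho_inv a p lambda Omega F (D^-1 * edist_to x (boundary Omega)) in
  t \is a fin_num /\ (sup_minorant Omega F x <= (a `^ fine t)%:E)%E.
Proof.
case: hOmega => Oex oO _ bO t.
have q0 : 0 < q by rewrite hq subr_gt0.
pose d := edist_to x (boundary Omega).
have d0 : 0 < d by apply: edist_boundary_gt0 => //; exact: leq_trans hk.
have dO : eball x d `<=` Omega by exact: eball_edist_sub.
pose T := [set s | `]lambda%:R, +oo[%classic s /\
                   (rho a p lambda Omega F s <= (D^-1 * d)%:E)%E].
have tE : t = ereal_inf [set s%:E | s in T] by [].
have [t1 t1lam rhot1] : exists2 t1 : R, lambda%:R < t1 &
    (rho a p lambda Omega F t1 <= (D^-1 * d)%:E)%E.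
  rewrite /rho -hq; apply: rho_small => //.
  - by move=> s s' _ ss'; exact: mu_anti.
  - by move=> s _; exact: mu_ge0.
  - by rewrite mulr_gt0// invr_gt0.
(* All admissible exponents exceed [lambda], and [t1] is one of them. *)
have tfin : t \is a fin_num.
  rewrite tE fin_numElt; apply/andP; split.
    apply: (@lt_le_trans _ _ lambda%:R%:E); first exact: ltNyr.
    apply: le_ereal_inf_tmp => _ [s [sl _] <-].
    by move: sl; rewrite /= in_itv/= andbT lee_fin => /ltW.
  apply: (@le_lt_trans _ _ t1%:E); last exact: ltry.
  by apply: ereal_inf_lbound; exists t1 => //; split; rewrite //= in_itv/= t1lam.
split => //; apply: ge_ereal_sup => _ [u uM <-].
rewrite hq in hDlambda.
have ule s : T s -> (u x <= (a `^ s)%:E)%E.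
  move=> [sl rhos]; move: sl; rewrite /= in_itv/= andbT => sl.
  exact: (minorant_le_of_rho ha hpk oO hF hmu hD hlambda hDlambda uM dO hx sl rhos).
(* The infimum need not be attained. If [u x = v] exceeded [a^t], then [ln v / ln a] would exceed
   [t], and some [s] in [T] below it would have [a^s < v]. *)
rewrite leNgt; apply/negP => ux.
have : (u x <= (a `^ t1)%:E)%E.
  by apply: ule; split; rewrite //= in_itv/= t1lam.
(* The bound at [t1] excludes [+oo], and the assumed lower bound excludes [-oo]. *)
case E : (u x) => [v| |]//; last by move: ux; rewrite E.
move=> _; rewrite E lte_fin in ux.
have a0 : 0 < a by rewrite (lt_trans ltr01).
have lna : 0 < ln a by exact: ln_gt0.
have v0 : 0 < v by rewrite (le_lt_trans (powR_ge0 a (fine t))).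
have tL : (t < (ln v / ln a)%:E)%E.
  rewrite -(fineK tfin) lte_fin ltr_pdivlMr// -ln_powR ltr_ln// ?posrE//.
  exact: powR_gt0.
rewrite tE in tL; have [_ [s Ts <-]] := ereal_inf_lt tL.
rewrite lte_fin ltr_pdivlMr// -ln_powR ltr_ln ?posrE ?powR_gt0// => av.
by have := ule _ Ts; rewrite E lee_fin leNgt av.
Qed.
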